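(* Let $n>1$ be an integer, let $L$ be a hyperbolic line in $H^n(\mathbb{R})$ and let $a\in H^n(\mathbb{R})$ with $a\notin L$. Then there are infinitely many hyperbolic lines that pass through $a$ and are disjoint from $L$.
   Context: The hyperbolic space is $H^n(\mathbb{R})=\mathbb{R}^n$ with the metric $d_h(x,y)=\cosh^{-1}([x][y]-\langle x,y\rangle)$, where $\langle\cdot,\cdot\rangle$ is the standard inner product, $[x]=\sqrt{1+\|x\|^2}$ with $\|\cdot\|$ the Euclidean norm, and $\cosh^{-1}(t)=\log(t+\sqrt{t^2-1})$ for $t\ge1$. A hyperbolic line is the image of the real line $\mathbb{R}$ (with its usual metric) under a distance-preserving map into $(H^n(\mathbb{R}),d_h)$. *)

(* Defs.v *)
From HB Require Import structures.
From mathcomp Require Import all_boot all_order all_algebra.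
From mathcomp Require Import all_classical all_reals all_analysis.

Set Implicit Arguments.
Unset Strict Implicit.
Unset Printing Implicit Defensive.

Import Order.TTheory GRing.Theory Num.Theory.

Local Open Scope classical_set_scope.
Local Open Scope ring_scope.

(* Only meaningful for 1 <= t; the values at t < 1 are junk. In hdist below the
   argument is always at least 1, by the Cauchy-Schwarz inequality. *)
Definition arcosh (R : realType) (t : R) : R := ln (t + Num.sqrt (t ^+ 2 - 1)).

Definition dotp (R : realType) (n : nat) (x y : 'rV[R]_n) : R :=
  \sum_(i < n) x 0 i * y 0 i.

(* The library norm `|x| on 'rV[R]_n is the sup norm, hence this definition. *)
Definition enorm (R : realType) (n : nat) (x : 'rV[R]_n) : R :=
  Num.sqrt (dotp x x).

Definition hbracket (R : realType) (n : nat) (x : 'rV[R]_n) : R :=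
  Num.sqrt (1 + enorm x ^+ 2).

Definition hdist (R : realType) (n : nat) (x y : 'rV[R]_n) : R :=
  arcosh (hbracket x * hbracket y - dotp x y).

Definition hyperbolic_line (R : realType) (n : nat) (L : set 'rV[R]_n) : Prop :=
  exists f : R -> 'rV[R]_n,
    (forall s t : R, hdist (f s) (f t) = `|s - t|) /\ L = range f.

(* Main.v *)
Require Import Defs.
From HB Require Import structures.
From mathcomp Require Import all_boot all_order all_algebra.
From mathcomp Require Import all_classical all_reals all_analysis.
From mathcomp Require Import ring lra.

Import Order.TTheory GRing.Theory Num.Theory.

Local Open Scope classical_set_scope.
Local Open Scope ring_scope.

(* In the hyperboloid model a hyperbolic line is the trace on the hyperboloid of
   a plane. Let L be the trace of the plane Q and let A be the lift of a, which
   is not in Q. If W is a spacelike vector of Q, then span(A, W) meets Q exactly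
   in the line R W, which misses the hyperboloid; so the trace of span(A, W) is
   a hyperbolic line through a disjoint from L. Non-proportional vectors W yield
   distinct lines, and Q contains infinitely many spacelike directions. *)

(** * Hyperbolic functions and [arcosh] *)

Definition cosh {R : realType} (t : R) : R := (expR t + expR (- t)) / 2.
Definition sinh {R : realType} (t : R) : R := (expR t - expR (- t)) / 2.

Section HyperbolicFunctions.
Set Implicit Arguments.
Unset Strict Implicit.
Variable R : realType.
Implicit Types s t c d : R.

Lemma cosh_sinh_sqr t : cosh t ^+ 2 - sinh t ^+ 2 = 1.
Proof. by rewrite -(expRxMexpNx_1 t) /cosh /sinh; field. Qed.

Lemma cosh_gt0 t : 0 < cosh t.
Proof. by rewrite divr_gt0// addr_gt0// expR_gt0. Qed.

Lemma sinh_ge0 t : 0 <= t -> 0 <= sinh t.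
Proof. by move=> t0; rewrite divr_ge0// subr_ge0 ler_expR; lra. Qed.

Lemma sinh1_neq0 : sinh 1 != 0 :> R.
Proof. by rewrite gt_eqF// divr_gt0// subr_gt0 ltr_expR; lra. Qed.

Lemma coshB s t : cosh (s - t) = cosh s * cosh t - sinh s * sinh t.
Proof. by rewrite /cosh /sinh opprB !expRD; field. Qed.

Lemma cosh_norm t : cosh `|t| = cosh t.
Proof.
by case: (ger0P t) => // _; rewrite /cosh opprK addrC.
Qed.

Lemma arcosh_cosh t : 0 <= t -> arcosh (cosh t) = t.
Proof.
move=> t0; rewrite /arcosh.
have -> : cosh t ^+ 2 - 1 = sinh t ^+ 2 by rewrite -(cosh_sinh_sqr t); ring.
rewrite sqrtr_sqr ger0_norm ?sinh_ge0//.
have -> : cosh t + sinh t = expR t by rewrite /cosh /sinh; field.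
exact: expRK.
Qed.

Lemma cosh_arcosh c : 1 <= c -> cosh (arcosh c) = c.
Proof.
move=> c1; rewrite /cosh /arcosh expRN.
set r := Num.sqrt _.
have r0 : 0 <= r by exact: sqrtr_ge0.
have r2 : r ^+ 2 = c ^+ 2 - 1 by rewrite sqr_sqrtr//; nra.
have cr : 0 < c + r by lra.
rewrite lnK//.
(* The conjugate is the inverse: [(c + r) * (c - r) = c ^+ 2 - r ^+ 2 = 1]. *)
have -> : (c + r)^-1 = c - r.
  apply: (mulfI (lt0r_neq0 cr)); rewrite divff ?lt0r_neq0//.
  by rewrite mulrC -subr_sqr r2; ring.
by field.
Qed.

(** Take [t = ln (c + d)]: since [(c + d) * (c - d) = 1], [expR (- t)] is [c - d]. *)
Lemma cosh_sinh_param c d : 0 < c -> c ^+ 2 - d ^+ 2 = 1 ->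
  exists t, cosh t = c /\ sinh t = d.
Proof.
move=> c0 cd; have cd1 : (c + d) * (c - d) = 1 by rewrite -cd; ring.
have cd0 : 0 < c + d by nra.
have e : expR (- ln (c + d)) = c - d.
  rewrite expRN lnK//; apply: (mulfI (lt0r_neq0 cd0)).
  by rewrite cd1 divff ?lt0r_neq0.
by exists (ln (c + d)); rewrite /cosh /sinh e lnK//; split; field.
Qed.

End HyperbolicFunctions.

(** * The Euclidean inner product *)

Section DotProduct.
Set Implicit Arguments.
Unset Strict Implicit.
Variables (R : realType) (n : nat).
Implicit Types x y z : 'rV[R]_n.

Lemma dotpC x y : dotp x y = dotp y x.
Proof. by apply: eq_bigr => i _; rewrite mulrC. Qed.

Lemma dotpDl x y z : dotp (x + y) z = dotp x z + dotp y z.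
Proof.
by rewrite /dotp -big_split; apply: eq_bigr => i _ /=; rewrite mxE mulrDl.
Qed.

Lemma dotpZl (c : R) x y : dotp (c *: x) y = c * dotp x y.
Proof.
by rewrite /dotp big_distrr; apply: eq_bigr => i _ /=; rewrite mxE mulrA.
Qed.

Lemma dotp_ge0 x : 0 <= dotp x x.
Proof. by apply: sumr_ge0 => i _; rewrite -expr2 sqr_ge0. Qed.

Lemma dotp_eq0 x : dotp x x <= 0 -> x = 0.
Proof.
move=> x0; have /eqP : dotp x x = 0 by apply/eqP; rewrite eq_le x0 dotp_ge0.
rewrite psumr_eq0 => [/allP h|i _]; last by rewrite -expr2 sqr_ge0.
apply/rowP => i; rewrite mxE.
by have := h i (mem_index_enum i); rewrite /= mulf_eq0 orbb => /eqP.
Qed.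

Lemma dotp_cauchy_schwarz x y : dotp x y ^+ 2 <= dotp x x * dotp y y.
Proof.
have [x0|x0] := leP (dotp x x) 0.
  rewrite (dotp_eq0 x0) -(scale0r (0 : 'rV[R]_n)) !dotpZl; lra.
(* [z] is [dotp x x] times the component of [y] orthogonal to [x]. *)
set z := dotp x x *: y + (- dotp x y) *: x.
have zz : dotp z z = dotp x x * (dotp x x * dotp y y - dotp x y ^+ 2).
  rewrite /z dotpDl !dotpZl !(dotpC _ (_ + _)) !dotpDl !dotpZl (dotpC y x); ring.
by have := dotp_ge0 z; rewrite zz pmulr_rge0// subr_ge0.
Qed.

End DotProduct.

(** * Minkowski space and the hyperboloid *)

Notation minkowski R n := (R^o * 'rV[R]_n)%type.

(** The form of signature [(1, n)]: spacelike vectors are those of negative square. *)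
Definition lorentz {R : realType} {n : nat} (X Y : minkowski R n) : R :=
  X.1 * Y.1 - dotp X.2 Y.2.

(* The hyperboloid model: [hdist] is the arcosh of the Lorentz form on lifts. *)
Definition lift_hyp {R : realType} {n : nat} (x : 'rV[R]_n) : minkowski R n :=
  (hbracket x, x).

Section Lorentz.
Set Implicit Arguments.
Unset Strict Implicit.
Variables (R : realType) (n : nat).
Local Notation T := (minkowski R n).
Implicit Types (X Y Z A U V W : T) (x y a p : 'rV[R]_n).

Lemma lorentzC X Y : lorentz X Y = lorentz Y X.
Proof. by rewrite /lorentz mulrC dotpC. Qed.

Lemma lorentzDl X Y Z : lorentz (X + Y) Z = lorentz X Z + lorentz Y Z.
Proof. by rewrite /lorentz /= dotpDl; ring. Qed.

Lemma lorentzZl (c : R) X Y : lorentz (c *: X) Y = c * lorentz X Y.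
Proof. by rewrite /lorentz /= dotpZl /GRing.scale /=; ring. Qed.

Lemma lorentzDr X Y Z : lorentz Z (X + Y) = lorentz Z X + lorentz Z Y.
Proof. by rewrite !(lorentzC Z) lorentzDl. Qed.

Lemma lorentzZr (c : R) X Y : lorentz Y (c *: X) = c * lorentz Y X.
Proof. by rewrite !(lorentzC Y) lorentzZl. Qed.

Definition lorentzE := (lorentzDl, lorentzDr, lorentzZl, lorentzZr).

Lemma hbracket_sqr x : hbracket x ^+ 2 = 1 + dotp x x.
Proof.
rewrite /hbracket /enorm !sqr_sqrtr ?dotp_ge0//.
by rewrite addr_ge0 ?dotp_ge0.
Qed.

Lemma hbracket_gt0 x : 0 < hbracket x.
Proof.
by rewrite /hbracket sqrtr_gt0 /enorm sqr_sqrtr ?dotp_ge0// ltr_wpDr ?dotp_ge0.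
Qed.

Lemma lorentz_lift x : lorentz (lift_hyp x) (lift_hyp x) = 1.
Proof. by rewrite /lorentz /= -expr2 hbracket_sqr; ring. Qed.

Lemma lorentz_lift_gt0 x y : 0 < lorentz (lift_hyp x) (lift_hyp y).
Proof.
rewrite /lorentz /= subr_gt0.
have hx := hbracket_gt0 x; have hy := hbracket_gt0 y.
apply: (@lt_le_trans _ _ `|hbracket x * hbracket y|); last first.
  by rewrite gtr0_norm// mulr_gt0.
apply: (le_lt_trans (ler_norm _)).
rewrite -ltr_sqr ?nnegrE// !real_normK ?num_real// exprMn !hbracket_sqr.
have := dotp_cauchy_schwarz x y; have := dotp_ge0 x; have := dotp_ge0 y.
nra.
Qed.

(** Unit vectors form two sheets; a positive product with one lift selects the upper sheet. *)
Lemma lift_of_unit X a : lorentz X X = 1 -> 0 < lorentz X (lift_hyp a) ->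
  X = lift_hyp X.2.
Proof.
move=> X1 Xa.
have X2 : X.1 ^+ 2 = hbracket X.2 ^+ 2.
  by rewrite hbracket_sqr -X1 /lorentz; ring.
have /eqP := X2; rewrite eqf_sqr => /orP[/eqP h|/eqP h].
  by case: X {X1 Xa X2} h => ? ? /= ->.
have dN : forall u v : 'rV[R]_n, dotp (- u) v = - dotp u v.
  by move=> u v; rewrite -scaleN1r dotpZl mulN1r.
(* On the lower sheet [- X] is the lift of [- X.2], so its product with the lift of [a] is also
   positive, against [Xa]. *)
have := lorentz_lift_gt0 (- X.2) a; move: Xa; rewrite /lorentz /= h dN.
have -> : hbracket (- X.2) = hbracket X.2.
  by rewrite /hbracket /enorm dN dotpC dN opprK.
by move=> ? ?; exfalso; lra.
Qed.

(* The tangent space of the hyperboloid at [A] is negative definite. *)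
Lemma lorentz_orthogonal_eq0 A W : lorentz A A = 1 -> lorentz A W = 0 ->
  0 <= lorentz W W -> W = 0.
Proof.
rewrite /lorentz => AA AW WW.
have cs := dotp_cauchy_schwarz A.2 W.2.
have w0 := dotp_ge0 W.2; have a0 := dotp_ge0 A.2.
have AW2 : A.1 ^+ 2 * W.1 ^+ 2 = dotp A.2 W.2 ^+ 2.
  by rewrite -exprMn; congr (_ ^+ 2); lra.
have A12 : A.1 ^+ 2 = 1 + dotp A.2 A.2 by lra.
(* Let [u] and [w] be the squares of [A.2] and [W.2]. As [w <= W.1 ^+ 2], Cauchy-Schwarz gives
   [(1 + u) * w <= u * w], so [w <= 0]. *)
have W20 : W.2 = 0 by apply: dotp_eq0; nra.
have W10 : W.1 = 0.
  move: AW2 WW; rewrite W20 -(scale0r (0 : 'rV[R]_n)) (dotpC A.2) !dotpZl.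
  rewrite !mul0r expr0n A12 => /eqP; rewrite mulf_eq0 sqrf_eq0.
  by case/orP => /eqP // ? _; lra.
by case: W W20 W10 {AW WW cs w0 AW2} => ? ? /= -> ->.
Qed.

(** If [c < 1], the component of [Y] orthogonal to [X] has positive square [1 - c ^+ 2], which
    negative definiteness forbids. *)
Lemma lorentz_lift_ge1 x y : 1 <= lorentz (lift_hyp x) (lift_hyp y).
Proof.
set X := lift_hyp x; set Y := lift_hyp y; set c := lorentz X Y.
have c0 : 0 < c by exact: lorentz_lift_gt0.
rewrite leNgt; apply/negP => c1.
have XX : lorentz X X = 1 := lorentz_lift x.
have YY : lorentz Y Y = 1 := lorentz_lift y.
set W := Y + (- c) *: X.
have WW : lorentz W W = 1 - c ^+ 2.
  by rewrite /W !lorentzE XX YY (lorentzC Y) -/c; ring.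
have W0 : W = 0.
  apply: (@lorentz_orthogonal_eq0 X) => //; last by rewrite WW; nra.
  by rewrite /W !lorentzE XX -/c; ring.
move: WW; rewrite W0 -(scale0r (0 : T)) lorentzZl mul0r; nra.
Qed.

Lemma cosh_hdist x y : cosh (hdist x y) = lorentz (lift_hyp x) (lift_hyp y).
Proof. exact/cosh_arcosh/lorentz_lift_ge1. Qed.

(** * Hyperbolic lines as plane sections of the hyperboloid *)

Definition hspan a W : set 'rV[R]_n :=
  [set x | exists c d : R, lift_hyp x = c *: lift_hyp a + d *: W].

Lemma lorentz_cosh_sinh A V s t : lorentz A A = 1 -> lorentz A V = 0 ->
  lorentz V V = -1 ->
  lorentz (cosh s *: A + sinh s *: V) (cosh t *: A + sinh t *: V)
  = cosh (s - t).
Proof.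
by move=> AA AV VV; rewrite !lorentzE (lorentzC V) AA AV VV coshB; ring.
Qed.

Lemma lift_geodesic a V t : lorentz (lift_hyp a) V = 0 -> lorentz V V = -1 ->
  lift_hyp (cosh t *: lift_hyp a + sinh t *: V).2
  = cosh t *: lift_hyp a + sinh t *: V.
Proof.
move=> aV VV; have aa := lorentz_lift a; apply/esym/(@lift_of_unit _ a).
  by rewrite lorentz_cosh_sinh// subrr /cosh oppr0 expR0; field.
by rewrite !lorentzE aa (lorentzC V) aV mulr0 addr0 mulr1 cosh_gt0.
Qed.

Lemma hspan_param a V x : lorentz (lift_hyp a) V = 0 -> lorentz V V = -1 ->
  hspan a V x -> exists t, lift_hyp x = cosh t *: lift_hyp a + sinh t *: V.
Proof.
move=> aV VV [c [d e]]; have aa := lorentz_lift a.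
(* [c] is the product of the lifts of [x] and [a], so [x] lies on the branch that [cosh]
   parametrizes. *)
have c0 : 0 < c.
  have := lorentz_lift_gt0 x a; rewrite e !lorentzE aa (lorentzC V) aV; lra.
have cd : c ^+ 2 - d ^+ 2 = 1.
  by rewrite -(lorentz_lift x) e !lorentzE aa (lorentzC V) aV VV; ring.
by have [t [ct st]] := cosh_sinh_param c0 cd; exists t; rewrite ct st.
Qed.

Lemma hyperbolic_line_orthonormal a V :
  lorentz (lift_hyp a) V = 0 -> lorentz V V = -1 ->
  hyperbolic_line (hspan a V).
Proof.
move=> aV VV; have aa := lorentz_lift a.
exists (fun t => (cosh t *: lift_hyp a + sinh t *: V).2); split.
  move=> s t; have -> : forall x y, hdist x y
    = arcosh (lorentz (lift_hyp x) (lift_hyp y)) by [].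
  by rewrite !lift_geodesic// lorentz_cosh_sinh// -cosh_norm arcosh_cosh.
apply/seteqP; split => x /=; last first.
  by case=> t _ <-; exists (cosh t), (sinh t); rewrite lift_geodesic.
case/(hspan_param aV VV) => t e; exists t => //.
by rewrite -[LHS]/((cosh t *: lift_hyp a + sinh t *: V).2) -e.
Qed.

(* An isometric f determines the Gram matrix of the lifts of f 0, f 1 and f t, by
   which (lift of f t) - (cosh t P + sinh t V) is isotropic and orthogonal to P,
   hence zero. *)
Lemma hyperbolic_line_hspan L : hyperbolic_line L ->
  exists p V, [/\ lorentz (lift_hyp p) V = 0, lorentz V V = -1 &
    L `<=>` hspan p V].
Proof.
case=> f [fd ->].
have G s t : lorentz (lift_hyp (f s)) (lift_hyp (f t)) = cosh (s - t).
  by rewrite -cosh_hdist fd cosh_norm.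
set P := lift_hyp (f 0); have PP : lorentz P P = 1 by exact: lorentz_lift.
have sh0 := sinh1_neq0 R.
(* [V] is the unit tangent at [P] towards [f 1], solved from [lift_hyp (f 1) = cosh 1 *: P + sinh 1
   *: V]. *)
have [V VE] : exists V, V = (sinh 1)^-1 *: (lift_hyp (f 1) + (- cosh 1) *: P).
  by eexists.
have GP t : lorentz (lift_hyp (f t)) P = cosh t by rewrite G subr0.
have PV : lorentz P V = 0.
  by rewrite VE !lorentzE PP lorentzC GP; ring.
have GV t : lorentz (lift_hyp (f t)) V = - sinh t.
  by rewrite VE !lorentzE G GP coshB; field.
have VV : lorentz V V = -1.
  by rewrite {1}VE !lorentzE GV PV; field.
exists (f 0), V; split => //; rewrite -/P.
suff key t : lift_hyp (f t) = cosh t *: P + sinh t *: V.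
  split=> x /=; first by case=> t _ <-; exists (cosh t), (sinh t).
  case/(hspan_param PV VV) => t e; exists t => //.
  suff : lift_hyp (f t) = lift_hyp x by case.
  by rewrite key; exact: esym e.
apply/eqP; rewrite -subr_eq0; apply/eqP.
have -> : lift_hyp (f t) - (cosh t *: P + sinh t *: V)
  = lift_hyp (f t) + ((- cosh t) *: P + (- sinh t) *: V).
  by rewrite opprD !scaleNr.
apply: (@lorentz_orthogonal_eq0 P) => //.
  by rewrite !lorentzE PP PV lorentzC GP; ring.
rewrite !lorentzE !(lorentzC _ (lift_hyp (f t))) GP GV (lorentzC V) PP PV VV.
rewrite (lorentz_lift (f t)).
by have := cosh_sinh_sqr t; lra.
Qed.

(** Gram-Schmidt: the component [W - w *: A] orthogonal to [A] has square [- q], which is negative,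
    and is rescaled by the inverse root of [q]. *)
Lemma hspan_orthonormalize a W : lorentz W W < 0 ->
  exists U (k b : R), [/\ k != 0, U = k *: W + b *: lift_hyp a,
    lorentz (lift_hyp a) U = 0 & lorentz U U = -1].
Proof.
move=> WW; set A := lift_hyp a; have AA : lorentz A A = 1 by exact: lorentz_lift.
set w := lorentz A W; set q := w ^+ 2 - lorentz W W.
have q0 : 0 < q by rewrite /q; nra.
have r0 : Num.sqrt q != 0 by rewrite gt_eqF// sqrtr_gt0.
have r2 : (Num.sqrt q)^-1 ^+ 2 * q = 1.
  by rewrite exprVn sqr_sqrtr ?ltW// mulVf// gt_eqF.
exists ((Num.sqrt q)^-1 *: W + (- (Num.sqrt q)^-1 * w) *: A).
exists (Num.sqrt q)^-1, (- (Num.sqrt q)^-1 * w); split => //.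
- by rewrite invr_eq0.
- by rewrite !lorentzE AA -/w; ring.
- rewrite !lorentzE AA (lorentzC W A) -/w.
  transitivity (- ((Num.sqrt q)^-1 ^+ 2 * q)); last by rewrite r2.
  by rewrite /q; ring.
Qed.

Lemma hspan_change a W (k b : R) : k != 0 ->
  hspan a (k *: W + b *: lift_hyp a) = hspan a W.
Proof.
move=> k0; apply/seteqP; split => x [c [d e]].
  exists (c + d * b), (d * k).
  by rewrite e scalerDr !scalerA scalerDl -addrA (addrC (_ *: W)).
exists (c - d / k * b), (d / k).
rewrite e scalerDr !scalerA divfK// scalerBl addrACA.
by rewrite addNr addr0.
Qed.

Lemma hyperbolic_line_spacelike a W : lorentz W W < 0 ->
  hyperbolic_line (hspan a W).
Proof.
move=> WW; have [U [k [b [k0 e aU UU]]]] := hspan_orthonormalize a WW.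
by rewrite -(hspan_change a W b k0) -e; exact: hyperbolic_line_orthonormal.
Qed.

Lemma hspan_base a W : hspan a W a.
Proof. by exists 1, 0; rewrite scale1r scale0r addr0. Qed.

(** A section determines its plane: a point of it other than [a] spans the plane together with the
    lift of [a]. *)
Lemma hspan_sub a W W' : lorentz W W < 0 -> hspan a W `<=` hspan a W' ->
  exists c d : R, W = c *: lift_hyp a + d *: W'.
Proof.
move=> WW sub; have [U [k [b [k0 e aU UU]]]] := hspan_orthonormalize a WW.
have sh0 := sinh1_neq0 R.
have /sub[c [d]] : hspan a W (cosh 1 *: lift_hyp a + sinh 1 *: U).2.
  rewrite -(hspan_change a W b k0) -e.
  by exists (cosh 1), (sinh 1); rewrite lift_geodesic.
rewrite lift_geodesic// e => h.
(* Solved for [W] from [cosh 1 *: A + sinh 1 *: (k *: W + b *: A) = c *: A + d *: W'], with [A] the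
   lift of [a]. *)
exists ((sinh 1 * k)^-1 * (c - cosh 1 - sinh 1 * b)), ((sinh 1 * k)^-1 * d).
have sk0 : sinh 1 * k != 0 by rewrite mulf_neq0.
apply: (scalerI sk0); rewrite scalerDr !scalerA !mulrA !mulfV// !mul1r.
rewrite 2!scalerBl addrAC (addrAC _ _ (d *: W')) -h.
by rewrite scalerDr !scalerA [X in X - _]addrAC subrr add0r addrK.
Qed.

End Lorentz.

Theorem theorem4p6 (R : realType) (n : nat) (n_gt1 : (1 < n)%N)
    (L : set 'rV[R]_n) (L_line : hyperbolic_line L)
    (a : 'rV[R]_n) (a_notin_L : ~ L a) :
  infinite_set [set M : set 'rV[R]_n |
    hyperbolic_line M /\ M a /\ M `&` L = set0].
Proof.
have [p [V [pV VV /seteqP LE]]] := hyperbolic_line_hspan L_line.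
move: a_notin_L; rewrite {}LE => aL.
set P := lift_hyp p; set A := lift_hyp a.
have PP : lorentz P P = 1 by exact: lorentz_lift.
(* [A] lies outside the plane of [P] and [V], since otherwise [a] would be on the line. *)
have notin c x y : c *: A = x *: P + y *: V -> c = 0.
  move=> h; apply/eqP/negP => /negP c0; apply: aL; exists (c^-1 * x), (c^-1 * y).
  by rewrite -!scalerA -scalerDr -h scalerA mulVf// scale1r.
(* [W k] has square [s k ^+ 2 - 1]; the shift by two keeps [s k] below 1, so [W k] is spacelike. *)
pose s (k : nat) : R := k.+2%:R^-1.
pose W k : minkowski R n := V + s k *: P.
have s01 k : 0 < s k < 1.
  by rewrite invr_gt0 ltr0n invf_lt1 ?ltr0n// ltr1n.
have WW k : lorentz (W k) (W k) < 0.
  have := s01 k => /andP[? ?].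
  by rewrite /W !lorentzE (lorentzC V) pV PP VV; nra.
pose M k := hspan a (W k).
have inj_M : {in setT &, injective M}.
  move=> k l _ _ /= h.
  have [c [d e]] : exists c d : R, W k = c *: A + d *: W l.
    by apply: hspan_sub => //; rewrite -/(M l) -h.
  (* [c *: A = W k - d *: W l] lies in the plane of [P] and [V]. *)
  have c0 : c = 0.
    apply: (notin _ (s k - d * s l) (1 - d)).
    apply: (addIr (d *: W l)); rewrite -e /W.
    rewrite scalerDr scalerA !scalerBl scale1r.
    by rewrite (addrC (d *: V)) addrACA subrK subrK addrC.
  rewrite c0 scale0r add0r in e.
  (* The product with [V] gives [d = 1], and then the product with [P] gives [s k = s l]. *)
  have eV : lorentz V (W k) = lorentz V (d *: W l) by rewrite e.
  have eP : lorentz P (W k) = lorentz P (d *: W l) by rewrite e.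
  move: eV eP; rewrite /W !lorentzE (lorentzC V) pV PP VV => eV eP.
  have : s k = s l by nra.
  by move/invr_inj/eqP; rewrite eqr_nat => /eqP[].
have sub_M : range M `<=`
    [set M | hyperbolic_line M /\ M a /\ M `&` hspan p V = set0].
  move=> _ [k _ <-] /=; split; first exact: hyperbolic_line_spacelike.
  split; first exact: hspan_base.
  apply/seteqP; split => // x [[c [d e]] [c' [d' e']]]; rewrite -/A -/P in e e'.
  (* A common point has its lift in both planes, so the lift is [d *: W k]; its square is then at
     most 0, yet a lift has square 1. *)
  have c0 : c = 0.
    apply: (notin _ (c' - d * s k) (d' - d)).
    apply: (addIr (d *: W k)); rewrite -e e' /W.
    rewrite scalerDr scalerA !scalerBl.
    by rewrite (addrC (d *: V)) addrACA subrK subrK.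
  have := lorentz_lift x; rewrite e c0 scale0r add0r lorentzZl lorentzZr.
  have := WW k; nra.
move=> /(sub_finite_set sub_M).
by rewrite (eq_finite_set (inj_card_eq inj_M)); exact: infinite_nat.
Qed.
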